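(* Let $M=\varprojlim M_i$ be a projective limit of Banach manifolds. If $\nabla=\varprojlim\nabla_i$ is a connection on $M$, with local components $\Gamma_\varphi=\varprojlim\Gamma_{\varphi_i}$, then $\{\Gamma_\varphi=\varprojlim\Gamma_{\varphi_i}\}$ forms a Christoffel structure on $M$.
   Context: Setting. $\{(M_i,\varphi_{ji})\}$ is a projective system of smooth Banach manifolds (with smooth connecting maps $\varphi_{ji}:M_j\to M_i$ for $j\ge i$), where $M_i$ is modelled on the Banach space $\mathbb E_i$ and $\{\mathbb E_i,\rho_{ji}\}$ is a projective system of Banach spaces with continuous linear maps $\rho_{ji}:\mathbb E_j\to\mathbb E_i$ and limit the Fréchet space $\mathbb F=\varprojlim\mathbb E_i$. Every $m=(m_i)\in M=\varprojlim M_i$ is assumed to have a projective system of charts $(U_i,\varphi_i)$ of $M_i$, $m_i\in U_i$, $\varphi_{ji}(U_j)\subseteq U_i$, $\varphi_i\circ\varphi_{ji}=\rho_{ji}\circ\varphi_j$ on $U_j$, such that $U=\varprojlim U_i$ is open in $M$ and $\varphi=\varprojlim\varphi_i$ maps $U$ onto an open subset of $\mathbb F$. Such $(U,\varphi)$ are the (projective limit) charts, which make $M$ a Fréchet manifold modelled on $\mathbb F$. $L^2(\mathbb E,\mathbb E)$ is the space of continuous bilinear maps $\mathbb E\times\mathbb E\to\mathbb E$, and $\mathcal H^2(\mathbb F,\mathbb F)$ is the Fréchet space of sequences $(B_i)\in\prod_iL^2(\mathbb E_i,\mathbb E_i)$ with $B_i\circ(\rho_{ji}\times\rho_{ji})=\rho_{ji}\circ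 B_j$ for $j\ge i$; such a sequence acts as a bilinear map $\varprojlim B_i$ on $\mathbb F$. Vector fields on $M$ are those of the form $X=\varprojlim X_i$ with $X_i$ a smooth vector field on $M_i$ and $T\varphi_{ji}\circ X_j=X_i\circ\varphi_{ji}$. $X_\varphi$ denotes the principal part of $X$ in the chart $(U,\varphi)$. Connections. A connection on a Banach manifold $N$ modelled on $\mathbb E$ is a map $(X,Y)\mapsto\nabla_XY$ on smooth vector fields such that for every chart $(U,\varphi)$ there is a smooth $\Gamma_\varphi:\varphi(U)\to L^2(\mathbb E,\mathbb E)$ with $(\nabla_XY)_\varphi(u)=DY_\varphi(u).X_\varphi(u)-\Gamma_\varphi(u)(X_\varphi(u),Y_\varphi(u))$. Connections $\nabla_i$ on $M_i$ form a projective system if in projective limit charts $\rho_{ji}\circ\Gamma_{\varphi_j}(u_j)=\Gamma_{\varphi_i}(\rho_{ji}u_j)\circ(\rho_{ji}\times\rho_{ji})$ for $j\ge i$; then $\nabla=\varprojlim\nabla_i$ is $\nabla_XY=\varprojlim(\nabla_i)_{X_i}Y_i$. A connection on $M$ is a map on vector fields given in projective limit charts by the same local formula with smooth $\Gamma_\varphi=\varprojlim\Gamma_{\varphi_i}:\varphi(U)\to\mathcal H^2(\mathbb F,\mathbb F)$. Christoffel structure on $M$. A family of smooth maps $\Gamma_\varphi=\varprojlim\Gamma_{\varphi_i}:\varphi(U)\to\mathcal H^2(\mathbb F,\mathbb F)$, one for each projective limit chart $(U,\varphi)$, such that for every two such charts $(U,\varphi),(V,\psi)$ around $m$ and all $e_1,e_2\in\mathbb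 F$, $\Gamma_\psi(v)(DF(u)e_1,DF(u)e_2)=DF(u).\Gamma_\varphi(u)(e_1,e_2)+D^2F(u)(e_1,e_2)$, where $u=\varphi(m)$, $v=\psi(m)$, $F=\psi\circ\varphi^{-1}=\varprojlim\psi_i\circ\varphi_i^{-1}$.
   Formalization: Each connection ∇_i on M_i is assumed to act on the smooth vector fields of every open subset of M_i, with the same local formula, not only on global fields; with global fields alone the claim can fail when a manifold has too few of them. *)

(* Defs.v *)
From HB Require Import structures.
From mathcomp Require Import all_boot all_order all_algebra.
From mathcomp Require Import all_classical all_reals all_analysis.

Set Implicit Arguments.
Unset Strict Implicit.
Unset Printing Implicit Defensive.

Import Order.TTheory GRing.Theory Num.Theory.
Import numFieldNormedType.Exports.

Local Open Scope classical_set_scope.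
Local Open Scope ring_scope.

Section SupNorm.
Context {R : realType} {T : Type} {W : normedModType R}.
Implicit Types (S : set T) (f g : T -> W).

Definition bounded_over S f := exists C : R, forall s, S s -> `|f s| <= C.

Definition supnorm S f : R := sup [set `|f s| | s in S].

Lemma le_supnorm S f s : bounded_over S f -> S s -> `|f s| <= supnorm S f.
Proof.
move=> [C bC] Ss; apply: ub_le_sup; last by exists s.
by exists C => _ [t St <-]; exact: bC.
Qed.

Lemma supnorm_le S f C : S !=set0 -> (forall s, S s -> `|f s| <= C) ->
  supnorm S f <= C.
Proof.
move=> [s Ss] bC; apply: ge_sup; first by exists `|f s|, s.
by move=> _ [t St <-]; exact: bC.
Qed.

Lemma supnormD S f g : S !=set0 -> bounded_over S f -> bounded_over S g ->
  supnorm S (f + g) <= supnorm S f + supnorm S g.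
Proof.
move=> S0 bf bg; apply: supnorm_le => // s Ss.
by apply: (le_trans (ler_normD _ _)); apply: lerD; exact: le_supnorm.
Qed.

Lemma supnormZ S f (l : R) : S !=set0 -> bounded_over S f ->
  supnorm S (l *: f) = `|l| * supnorm S f.
Proof.
move=> S0 bf; have leZ a g : bounded_over S g ->
    supnorm S (a *: g) <= `|a| * supnorm S g.
  move=> bg; apply: supnorm_le => // s Ss.
  by rewrite normrZ; apply: ler_wpM2l => //; exact: le_supnorm.
have [->|l0] := eqVneq l 0.
  apply/eqP; rewrite normr0 mul0r eq_le; apply/andP; split.
    by apply: supnorm_le => // s _; rewrite scale0r normr0.
  have [s Ss] := S0; apply: (le_trans (normr_ge0 ((0 *: f) s))).
  by apply: le_supnorm => //; exists 0 => t _; rewrite scale0r normr0.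
apply/eqP; rewrite eq_le leZ //= -ler_pdivlMl ?normr_gt0 // -normfV.
rewrite -{1}[f](scalerK l0); apply: leZ; have [C bC] := bf.
by exists (`|l| * C) => s Ss; rewrite normrZ ler_wpM2l // bC.
Qed.

End SupNorm.

Section ContinuousLinear.
Context {R : realType} (V W : normedModType R).

Definition is_lop : {pred V -> W} := fun f => `[< linear f /\ continuous f >].

Definition Lop := {f : V -> W | f \in is_lop}.

Definition Lop_fun (f : Lop) : V -> W := val f.
Coercion Lop_fun : Lop >-> Funclass.

Lemma is_lop_submod : submod_closed is_lop.
Proof.
split=> [|a f g /asboolP[lf cf] /asboolP[lg cg]]; apply/asboolP; split.
- by move=> a x y /=; rewrite scaler0 addr0.
- by move=> x; exact: cvg_cst.
- move=> b x y; rewrite !fctE lf lg !scalerDr !scalerA (mulrC a b).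
  by rewrite addrACA.
- by move=> x; apply: cvgD; [apply: cvgZl_tmp; exact: cf|exact: cg].
Qed.

HB.instance Definition _ := GRing.isSubmodClosed.Build R (V -> W) is_lop
  is_lop_submod.
HB.instance Definition _ := SubChoice.on Lop.
HB.instance Definition _ := [SubChoice_isSubLmodule of Lop by <:].

Let B : set V := [set x | `|x| <= 1].
Let B0 : B !=set0. Proof. by exists 0; rewrite /B /= normr0. Qed.

Lemma Lop_linear (f : Lop) : linear f.
Proof. by have /asboolP[] := valP f. Qed.

Lemma Lop_continuous (f : Lop) : continuous f.
Proof. by have /asboolP[] := valP f. Qed.

Lemma Lop0 (f : Lop) : f 0 = 0.
Proof.
have := Lop_linear f (-1) 0 0.
by rewrite scaleN1r oppr0 addr0 scaleN1r addNr.
Qed.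

Lemma LopZ (f : Lop) a x : f (a *: x) = a *: f x.
Proof. by have := Lop_linear f a x 0; rewrite Lop0 !addr0. Qed.

Lemma Lop_bounded (f : Lop) : bounded_over B f.
Proof.
have /cvgr0Pnorm_lt/(_ 1 ltr01) : f x @[x --> 0] --> 0.
  by rewrite -[X in _ --> X](Lop0 f); exact: Lop_continuous.
move=> /nbhs_ballP[d /= d0 Bd].
exists (2 / d) => x Bx; have d2 : 0 < d / 2 by rewrite divr_gt0.
have : `|f ((d / 2) *: x)| < 1.
  apply: Bd; rewrite -ball_normE /ball_ /= sub0r normrN normrZ gtr0_norm //.
  apply: le_lt_trans (_ : d / 2 < d); first by rewrite ler_piMr // ltW.
  by rewrite ltr_pdivrMr // ltr_pMr // ltr1n.
rewrite LopZ normrZ gtr0_norm // -ltr_pdivlMl // mulr1 invf_div.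
exact: ltW.
Qed.

Definition Lop_norm (f : Lop) : R := supnorm B f.

Lemma Lop_normD f g : Lop_norm (f + g) <= Lop_norm f + Lop_norm g.
Proof. by apply: supnormD => //; exact: Lop_bounded. Qed.

Lemma Lop_normZ (l : R) f : Lop_norm (l *: f) = `|l| * Lop_norm f.
Proof. by apply: supnormZ => //; exact: Lop_bounded. Qed.

Lemma Lop_norm_eq0 f : Lop_norm f = 0 -> f = 0.
Proof.
move=> f0; apply/val_inj/funext => x /=.
have [->|x0] := eqVneq x 0; first exact: Lop0.
have : `|f (`|x|^-1 *: x)| <= 0.
  rewrite -f0; apply: le_supnorm; first exact: Lop_bounded.
  by rewrite /B /= normrZ normfV normr_id mulVf ?normr_eq0.
rewrite LopZ normrZ normfV normr_id pmulr_rle0 ?invr_gt0 ?normr_gt0 //.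
by rewrite normr_le0 => /eqP.
Qed.

HB.instance Definition _ := Lmodule_isNormed.Build R Lop
  Lop_normD Lop_normZ Lop_norm_eq0.

End ContinuousLinear.

Section ContinuousBilinear.
Context {R : realType} (V W : normedModType R).

Definition is_bop : {pred V * V -> W} := fun f =>
  `[< [/\ forall x, linear (fun y => f (x, y)),
          forall y, linear (fun x => f (x, y)) & continuous f] >].

Definition Bop := {f : V * V -> W | f \in is_bop}.

Definition Bop_fun (f : Bop) : V -> V -> W := fun x y => val f (x, y).
Coercion Bop_fun : Bop >-> Funclass.

Lemma is_bop_submod : submod_closed is_bop.
Proof.
split=> [|a f g /asboolP[lf rf cf] /asboolP[lg rg cg]]; apply/asboolP; split.
- by move=> z a x y /=; rewrite scaler0 addr0.
- by move=> z a x y /=; rewrite scaler0 addr0.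
- by move=> x; exact: cvg_cst.
- move=> z b x y; rewrite !fctE lf lg !scalerDr !scalerA (mulrC a b).
  by rewrite addrACA.
- move=> z b x y; rewrite !fctE rf rg !scalerDr !scalerA (mulrC a b).
  by rewrite addrACA.
- by move=> x; apply: cvgD; [apply: cvgZl_tmp; exact: cf|exact: cg].
Qed.

HB.instance Definition _ := GRing.isSubmodClosed.Build R (V * V -> W) is_bop
  is_bop_submod.
HB.instance Definition _ := SubChoice.on Bop.
HB.instance Definition _ := [SubChoice_isSubLmodule of Bop by <:].

Let B : set (V * V) := [set z | `|z.1| <= 1 /\ `|z.2| <= 1].
Let B0 : B !=set0. Proof. by exists 0; rewrite /B /= normr0. Qed.

Lemma Bop_linearr (f : Bop) x : linear (f x).
Proof. by have /asboolP[lf _ _] := valP f; exact: lf. Qed.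

Lemma Bop_linearl (f : Bop) y : linear (f ^~ y).
Proof. by have /asboolP[_ rf _] := valP f; exact: rf. Qed.

Lemma Bop_continuous (f : Bop) : continuous (fun z => f z.1 z.2).
Proof.
have /asboolP[_ _ cf] := valP f.
by under eq_fun do rewrite /Bop_fun -surjective_pairing.
Qed.

Lemma Bop0r (f : Bop) x : f x 0 = 0.
Proof.
have := Bop_linearr f x (-1) 0 0.
by rewrite scaleN1r oppr0 addr0 scaleN1r addNr.
Qed.

Lemma Bop0l (f : Bop) y : f 0 y = 0.
Proof.
have := Bop_linearl f y (-1) 0 0.
by rewrite scaleN1r oppr0 addr0 scaleN1r addNr.
Qed.

Lemma BopZr (f : Bop) a x y : f x (a *: y) = a *: f x y.
Proof. by have := Bop_linearr f x a y 0; rewrite Bop0r !addr0. Qed.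

Lemma BopZl (f : Bop) a x y : f (a *: x) y = a *: f x y.
Proof. by have := Bop_linearl f y a x 0; rewrite Bop0l !addr0. Qed.

Lemma Bop_bounded (f : Bop) : bounded_over B (val f).
Proof.
have f0 : f (0 : V * V).1 (0 : V * V).2 = 0 := Bop0l f 0.
have /cvgr0Pnorm_lt/(_ 1 ltr01) : f z.1 z.2 @[z --> (0 : V * V)] --> 0.
  by rewrite -[X in _ --> X]f0; exact: (@Bop_continuous f (0 : V * V)).
move=> /nbhs_ballP[d /= d0 Bd].
have d2 : 0 < d / 2 by rewrite divr_gt0.
have dd : d / 2 < d by rewrite ltr_pdivrMr // ltr_pMr // ltr1n.
exists (2 / d * (2 / d)) => -[x y] [/= Bx By].
have : `|f ((d / 2) *: x) ((d / 2) *: y)| < 1.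
  apply: (Bd ((d / 2) *: x, (d / 2) *: y)).
  split; rewrite -ball_normE /ball_ /= sub0r normrN normrZ gtr0_norm //;
    by apply: le_lt_trans dd; rewrite ler_piMr // ltW.
rewrite BopZl BopZr !(normrZ (d / 2)) (gtr0_norm d2) mulrA.
rewrite -(ltr_pdivlMl _ _ (mulr_gt0 d2 d2)) mulr1 invfM invf_div.
exact: ltW.
Qed.

Definition Bop_norm (f : Bop) : R := supnorm B (val f).

Lemma Bop_normD f g : Bop_norm (f + g) <= Bop_norm f + Bop_norm g.
Proof. by apply: supnormD => //; exact: Bop_bounded. Qed.

Lemma Bop_normZ (l : R) f : Bop_norm (l *: f) = `|l| * Bop_norm f.
Proof. by apply: supnormZ => //; exact: Bop_bounded. Qed.

Lemma Bop_norm_eq0 f : Bop_norm f = 0 -> f = 0.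
Proof.
move=> f0; apply/val_inj/funext => -[x y] /=.
have [->|x0] := eqVneq x 0; first exact: (Bop0l f).
have [->|y0] := eqVneq y 0; first exact: (Bop0r f).
have : `|f (`|x|^-1 *: x) (`|y|^-1 *: y)| <= 0.
  rewrite -f0; apply: (@le_supnorm _ _ _ _ _ (_, _)); first exact: Bop_bounded.
  by split; rewrite /= normrZ normfV normr_id mulVf ?normr_eq0.
rewrite BopZl BopZr !normrZ !normfV !normr_id.
rewrite !pmulr_rle0 ?invr_gt0 ?normr_gt0 //.
by rewrite normr_le0 => /eqP.
Qed.

HB.instance Definition _ := Lmodule_isNormed.Build R Bop
  Bop_normD Bop_normZ Bop_norm_eq0.

End ContinuousBilinear.

(* C^k in the sense of Frechet, on an open set U; f is a total function whose
   values outside U are irrelevant. *)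
Fixpoint Ck {R : realType} (k : nat) (V W : normedModType R) (U : set V)
    (f : V -> W) : Prop :=
  if k is k'.+1 then
    exists2 f' : V -> Lop V W,
      forall x, U x -> is_diff x f (f' x) & Ck k' U f'
  else forall x, U x -> {for x, continuous f}.

Definition smooth_on {R : realType} (V W : normedModType R) (U : set V)
  (f : V -> W) := forall k, Ck k U f.

HB.instance Definition _ (R : realType) (V W : preTopologicalLmodType R) :=
  GRing.Lmodule.on (V * W)%type.

(* Beyond normed spaces, smoothness is that of Michal-Bastiani (the one of
   Hamilton for Frechet spaces): iterated directional derivatives exist and
   are jointly continuous. *)
Definition diff_quot {R : realType} {V W : preTopologicalLmodType R}
  (f : V -> W) (x h : V) (t : R) : W := t^-1 *: (f (x + t *: h) - f x).

Fixpoint bastiani_Ck {R : realType} (k : nat) (V W : preTopologicalLmodType R)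
    (U : set V) (f : V -> W) : Prop :=
  (forall x, U x -> {for x, continuous f}) /\
  if k is k'.+1 then
    exists2 df : V * V -> W,
      forall x h, U x -> diff_quot f x h t @[t --> 0^'] --> df (x, h) &
      bastiani_Ck k' (U `*` [set: V]) df
  else True.

Definition bastiani_smooth_on {R : realType} (V W : preTopologicalLmodType R)
  (U : set V) (f : V -> W) := forall k, bastiani_Ck k U f.

Section ProductLmodule.
Context {R : realType} (I : Type) (E : I -> normedModType R).
Local Notation P := (prod_topology (fun i => E i)).
Implicit Types x y : P.

Definition prodtop_zero : P := fun=> 0.
Definition prodtop_opp x : P := fun i => - x i.
Definition prodtop_add x y : P := fun i => x i + y i.
Definition prodtop_scale (a : R) x : P := fun i => a *: x i.

Let eqp x y : (forall i, x i = y i) -> x = y.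
Proof. exact: functional_extensionality_dep. Qed.

Fact prodtop_addA : associative prodtop_add.
Proof. by move=> x y z; apply: eqp => i; exact: addrA. Qed.
Fact prodtop_addC : commutative prodtop_add.
Proof. by move=> x y; apply: eqp => i; exact: addrC. Qed.
Fact prodtop_add0 : left_id prodtop_zero prodtop_add.
Proof. by move=> x; apply: eqp => i; exact: add0r. Qed.
Fact prodtop_addN : left_inverse prodtop_zero prodtop_opp prodtop_add.
Proof. by move=> x; apply: eqp => i; exact: addNr. Qed.

HB.instance Definition _ := GRing.isZmodule.Build P
  prodtop_addA prodtop_addC prodtop_add0 prodtop_addN.

Fact prodtop_scaleA a b x :
  prodtop_scale a (prodtop_scale b x) = prodtop_scale (a * b) x.
Proof. by apply: eqp => i; exact: scalerA. Qed.
Fact prodtop_scale1 : left_id 1 prodtop_scale.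
Proof. by move=> x; apply: eqp => i; exact: scale1r. Qed.
Fact prodtop_scaleDr : right_distributive prodtop_scale +%R.
Proof. by move=> a x y; apply: eqp => i; exact: scalerDr. Qed.
Fact prodtop_scaleDl x :
  {morph prodtop_scale^~ x : a b / a + b >-> a + b}.
Proof. by move=> a b; apply: eqp => i; exact: scalerDl. Qed.

HB.instance Definition _ := GRing.Zmodule_isLmodule.Build R P
  prodtop_scaleA prodtop_scale1 prodtop_scaleDr prodtop_scaleDl.

End ProductLmodule.

Record banach_system (R : realType) := BanachSystem {
  bspace :> nat -> completeNormedModType R ;
  (* for ij : i <= j, rho ij is $\rho_{ji}$ *)
  rho : forall i j, (i <= j)%N -> Lop (bspace j) (bspace i) ;
  rho_id : forall i (ii : (i <= i)%N) x, rho ii x = x ;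
  rho_comp : forall i j k (ij : (i <= j)%N) (jk : (j <= k)%N) (ik : (i <= k)%N)
    x, rho ij (rho jk x) = rho ik x }.
Arguments rho {R} E {i j} ij : rename.

Section ProjectiveLimit.
Context {R : realType} (E : banach_system R).

Definition is_thread : {pred prod_topology (fun i => E i)} := fun x =>
  `[< forall i j (ij : (i <= j)%N), rho E ij (x j) = x i >].

Definition plim := {x : prod_topology (fun i => E i) | x \in is_thread}.

Definition plim_at (x : plim) (i : nat) : E i := val x i.
Coercion plim_at : plim >-> Funclass.

Lemma is_thread_submod : submod_closed is_thread.
Proof.
split=> [|a x y /asboolP tx /asboolP ty]; apply/asboolP => i j ij.
  exact: Lop0.
by rewrite (Lop_linear (rho E ij)) tx // ty.
Qed.

HB.instance Definition _ := GRing.isSubmodClosed.Build R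
  (prod_topology (fun i => E i)) is_thread is_thread_submod.
HB.instance Definition _ := SubChoice.on plim.
HB.instance Definition _ := [SubChoice_isSubLmodule of plim by <:].
HB.instance Definition _ := isPointed.Build plim 0.
HB.instance Definition _ := Topological.copy plim
  (initial_topology (val : plim -> prod_topology (fun i => E i))).

Definition is_H2 : {pred prod_topology (fun i => Bop (E i) (E i))} := fun B =>
  `[< forall i j (ij : (i <= j)%N) x y,
        B i (rho E ij x) (rho E ij y) = rho E ij (B j x y) >].

Definition H2 := {B : prod_topology (fun i => Bop (E i) (E i)) | B \in is_H2}.

Definition H2_at (B : H2) (i : nat) : Bop (E i) (E i) := val B i.
Coercion H2_at : H2 >-> Funclass.

Lemma is_H2_submod : submod_closed is_H2.
Proof.
split=> [|a B C /asboolP hB /asboolP hC]; apply/asboolP => i j ij x y.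
  by rewrite [RHS]Lop0.
have eqD k (u v : E k) : Bop_fun ((a *: B + C) k) u v =
  a *: Bop_fun (B k) u v + Bop_fun (C k) u v by [].
by rewrite !eqD hB // hC // -(Lop_linear (rho E ij)).
Qed.

HB.instance Definition _ := GRing.isSubmodClosed.Build R
  (prod_topology (fun i => Bop (E i) (E i))) is_H2 is_H2_submod.
HB.instance Definition _ := SubChoice.on H2.
HB.instance Definition _ := [SubChoice_isSubLmodule of H2 by <:].
HB.instance Definition _ := isPointed.Build H2 0.
HB.instance Definition _ := Topological.copy H2
  (initial_topology (val : H2 -> prod_topology (fun i => Bop (E i) (E i)))).

(* The element of the limit with given components; 0 if these do not form a
   thread. *)
Definition mk_plim (x : forall i, E i) : plim :=
  insubd 0 (x : prod_topology (fun i => E i)).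
Definition mk_H2 (B : forall i, Bop (E i) (E i)) : H2 :=
  insubd 0 (B : prod_topology (fun i => Bop (E i) (E i))).

Definition H2_app (B : H2) (x y : plim) : plim :=
  mk_plim (fun i => B i (x i) (y i)).

Definition fderive (f : plim -> plim) (u e : plim) : plim :=
  lim (diff_quot f u e t @[t --> 0^']).

(* $D^2f(u)(e_1, e_2)$: as for D(Df), e1 is the direction of the second
   differentiation. *)
Definition fderive2 (f : plim -> plim) (u e1 e2 : plim) : plim :=
  fderive (fun u' => fderive f u' e2) u e1.

End ProjectiveLimit.

Record chart (N : topologicalType) (R : realType) (E : normedModType R) :=
  Chart {
    cdom : set N ;
    cmap :> N -> E ;
    cinv : E -> N ;
    cdom_open : open cdom ;
    cmap_open : open (cmap @` cdom) ;
    cmapK : {in cdom, cancel cmap cinv} ;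
    cmap_cont : forall m, cdom m -> {for m, continuous cmap} ;
    cinv_cont : forall u, (cmap @` cdom) u -> {for u, continuous cinv} }.

Definition smooth_transition (N : topologicalType) (R : realType)
    (E : normedModType R) (phi psi : chart N E) :=
  smooth_on (phi @` (cdom phi `&` cdom psi)) (psi \o cinv phi).

Record bmanifold (R : realType) (E : completeNormedModType R) := BManifold {
  bcarrier :> topologicalType ;
  atlas : set (chart bcarrier E) ;
  atlas_cover : forall m, exists2 phi, atlas phi & cdom phi m ;
  atlas_smooth : forall phi psi, atlas phi -> atlas psi ->
    smooth_transition phi psi ;
  atlas_max : forall phi,
    (forall psi, atlas psi ->
       smooth_transition phi psi /\ smooth_transition psi phi) -> atlas phi }.

Definition smooth_map (R : realType) (E E' : completeNormedModType R)
    (N : bmanifold E) (N' : bmanifold E') (f : N -> N') :=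
  continuous f /\
  forall phi psi, atlas phi -> atlas psi ->
    smooth_on (phi @` (cdom phi `&` f @^-1` cdom psi)) (psi \o f \o cinv phi).

Section TangentVectors.
Context {R : realType} {E : completeNormedModType R} (N : bmanifold E).

Definition chart_at (m : N) (phi : chart N E) := atlas phi /\ cdom phi m.

(* A tangent vector at m is the family of its representatives (principal
   parts) in the charts around m. *)
Record tangent (m : N) := Tangent {
  ppart : chart N E -> E ;
  ppart_compat : forall phi psi, chart_at m phi -> chart_at m psi ->
    ppart psi = 'd (psi \o cinv phi) (phi m) (ppart phi) ;
  ppart_junk : forall phi, ~ chart_at m phi -> ppart phi = 0 }.

Definition section := forall m : N, tangent m.

Definition vf_ppart (X : section) (phi : chart N E) (u : E) : E :=
  ppart (X (cinv phi u)) phi.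

Definition smooth_vf (W : set N) (X : section) :=
  forall phi, atlas phi -> smooth_on (phi @` (cdom phi `&` W)) (vf_ppart X phi).

(* A connection acts on the smooth vector fields of every open subset W of N,
   not only on the global ones: a Banach manifold need not have smooth cutoff
   functions, and its global vector fields may be too scarce for the local
   formula to determine the components. The values of nabla W X Y outside W
   are irrelevant. *)
Definition is_connection (nabla : set N -> section -> section -> section)
    (Gamma : chart N E -> E -> Bop E E) :=
  (forall W X Y, open W -> smooth_vf W X -> smooth_vf W Y ->
     smooth_vf W (nabla W X Y)) /\
  forall phi, atlas phi ->
    smooth_on (phi @` cdom phi) (Gamma phi) /\
    forall W X Y, open W -> smooth_vf W X -> smooth_vf W Y ->
    forall u, (phi @` (cdom phi `&` W)) u ->
      vf_ppart (nabla W X Y) phi u =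
        'd (vf_ppart Y phi) u (vf_ppart X phi u)
        - Gamma phi u (vf_ppart X phi u) (vf_ppart Y phi u).

End TangentVectors.
Arguments section {R E} N.

(* T f v = w *)
Definition tangent_map (R : realType) (E E' : completeNormedModType R)
    (N : bmanifold E) (N' : bmanifold E') (f : N -> N') (m : N)
    (v : tangent m) (w : tangent (f m)) :=
  forall phi psi, chart_at m phi -> chart_at (f m) psi ->
    ppart w psi = 'd (psi \o f \o cinv phi) (phi m) (ppart v phi).

Record manifold_system (R : realType) (E : banach_system R) :=
  ManifoldSystem {
    msp :> forall i, bmanifold (E i) ;
    (* for ij : i <= j, mmap ij is $\varphi_{ji}$ *)
    mmap : forall i j, (i <= j)%N -> msp j -> msp i ;
    mmap_smooth : forall i j (ij : (i <= j)%N), smooth_map (mmap ij) ;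
    mmap_id : forall i (ii : (i <= i)%N) m, mmap ii m = m ;
    mmap_comp : forall i j k (ij : (i <= j)%N) (jk : (j <= k)%N)
      (ik : (i <= k)%N) m, mmap ij (mmap jk m) = mmap ik m }.
Arguments mmap {R E} M {i j} ij : rename.

Section LimitManifold.
Context {R : realType} {E : banach_system R} (M : manifold_system E).

Definition mlim :=
  {m : prod_topology (fun i => M i) |
    `[< forall i j (ij : (i <= j)%N), mmap M ij (m j) = m i >]}.

Definition mlim_at (m : mlim) (i : nat) : M i := val m i.
Coercion mlim_at : mlim >-> Funclass.

HB.instance Definition _ := SubChoice.on mlim.
HB.instance Definition _ := Topological.copy mlim
  (initial_topology (val : mlim -> prod_topology (fun i => M i))).

Definition lim_dom (phi : forall i, chart (M i) (E i)) : set mlim :=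
  [set m | forall i, cdom (phi i) (m i)].

Definition lim_map (phi : forall i, chart (M i) (E i)) (m : mlim) : plim E :=
  mk_plim (fun i => phi i (m i)).

Record pchart := PChart {
  pc :> forall i, chart (M i) (E i) ;
  lim_inv : plim E -> mlim ;
  pc_atlas : forall i, atlas (pc i) ;
  pc_dom : forall i j (ij : (i <= j)%N),
    mmap M ij @` cdom (pc j) `<=` cdom (pc i) ;
  pc_commute : forall i j (ij : (i <= j)%N) m, cdom (pc j) m ->
    pc i (mmap M ij m) = rho E ij (pc j m) ;
  pc_dom_open : open (lim_dom pc) ;
  pc_img_open : open (lim_map pc @` lim_dom pc) ;
  lim_mapK : forall m, lim_dom pc m -> lim_inv (lim_map pc m) = m }.

Definition has_pcharts := forall m : mlim, exists phi : pchart, lim_dom phi m.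

Definition pc_img (phi : pchart) : set (plim E) := lim_map phi @` lim_dom phi.

Definition ptransition (phi psi : pchart) : plim E -> plim E :=
  lim_map psi \o lim_inv phi.

(* Sections of TM, with $T_mM = \varprojlim T_{m_i}M_i$. *)
Definition psection := forall (m : mlim) (i : nat), tangent (m i).

Definition lim_vf (X : forall i, section (M i)) : psection :=
  fun m i => X i (m i).

Definition vf_system (X : forall i, section (M i)) :=
  (forall i, smooth_vf [set: M i] (X i)) /\
  forall i j (ij : (i <= j)%N) m,
    tangent_map (f := mmap M ij) (X j m) (X i (mmap M ij m)).

Definition vector_field (X : psection) :=
  exists2 Xs, vf_system Xs & X = lim_vf Xs.

Definition pvf_ppart (X : psection) (phi : pchart) (u : plim E) : plim E :=
  mk_plim (fun i => ppart (X (lim_inv phi u) i) (phi i)).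

(* Gamma, restricted to phi(U), is a smooth map into H2 of the form
   $\varprojlim \Gamma_{\varphi_i}$. *)
Definition smooth_plim_map (phi : pchart) (Gamma : plim E -> H2 E) :=
  bastiani_smooth_on (pc_img phi) Gamma /\
  exists G : forall i, E i -> Bop (E i) (E i),
    [/\ forall i, smooth_on (phi i @` cdom (phi i)) (G i),
        forall i j (ij : (i <= j)%N) u x y, (phi j @` cdom (phi j)) u ->
          rho E ij (G j u x y) =
            G i (rho E ij u) (rho E ij x) (rho E ij y) &
        forall u i, pc_img phi u -> Gamma u i = G i (u i)].

Definition is_pconnection (nabla : psection -> psection -> psection)
    (Gamma : pchart -> plim E -> H2 E) :=
  (forall X Y, vector_field X -> vector_field Y ->
     vector_field (nabla X Y)) /\
  forall phi, smooth_plim_map phi (Gamma phi) /\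
    forall X Y, vector_field X -> vector_field Y ->
    forall u, pc_img phi u ->
      pvf_ppart (nabla X Y) phi u =
        fderive (pvf_ppart Y phi) u (pvf_ppart X phi u)
        - H2_app (Gamma phi u) (pvf_ppart X phi u) (pvf_ppart Y phi u).

Definition projective_components
    (Gamma : forall i, chart (M i) (E i) -> E i -> Bop (E i) (E i)) :=
  forall (phi : pchart) i j (ij : (i <= j)%N),
    forall u, (phi j @` cdom (phi j)) u -> forall x y,
    rho E ij (Gamma j (phi j) u x y) =
      Gamma i (phi i) (rho E ij u) (rho E ij x) (rho E ij y).

Definition lim_components
    (Gamma : forall i, chart (M i) (E i) -> E i -> Bop (E i) (E i))
    (phi : pchart) (u : plim E) : H2 E :=
  mk_H2 (fun i => Gamma i (phi i) (u i)).

Definition is_lim_connection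
    (nablas : forall i, set (M i) -> section (M i) -> section (M i) ->
       section (M i))
    (nabla : psection -> psection -> psection) :=
  forall X Y, vf_system X -> vf_system Y ->
    nabla (lim_vf X) (lim_vf Y) =
      lim_vf (fun i => nablas i [set: M i] (X i) (Y i)).

Definition christoffel_structure (Gamma : pchart -> plim E -> H2 E) :=
  (forall phi, smooth_plim_map phi (Gamma phi)) /\
  forall (phi psi : pchart) m, lim_dom phi m -> lim_dom psi m ->
    let u := lim_map phi m in let v := lim_map psi m in
    let F := ptransition phi psi in
    forall e1 e2 : plim E,
      H2_app (Gamma psi v) (fderive F u e1) (fderive F u e2) =
        fderive F u (H2_app (Gamma phi u) e1 e2) + fderive2 F u e1 e2.

End LimitManifold.

(* Main.v *)
From HB Require Import structures.
Require Import Defs.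
From mathcomp Require Import all_boot all_order all_algebra.
From mathcomp Require Import all_classical all_reals all_analysis.

Set Implicit Arguments.
Unset Strict Implicit.
Unset Printing Implicit Defensive.

Import Order.TTheory GRing.Theory Num.Theory.
Import numFieldNormedType.Exports.

Local Open Scope classical_set_scope.
Local Open Scope ring_scope.

(** The Christoffel law on the limit is the componentwise limit of the classical
law on each Banach manifold M_i, so there are two things to prove.

On a Banach manifold, evaluate the local formula of the connection, in two
charts phi and psi around m, at the vector fields X and Y that are constant in
the chart phi, with values e1 and e2 there.  In phi the derivative of the
principal part of Y vanishes, so nabla_X Y reads - Gamma_phi(u)(e1, e2).  In psi
the principal part of Y is DF(F^-1 v) e2, whose derivative along DF(u) e1 is
D^2F(u)(e1, e2) by the chain rule, so nabla_X Y reads D^2F(u)(e1, e2) -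
Gamma_psi(v)(DF(u) e1, DF(u) e2).  The two expressions are the principal parts
of one tangent vector, hence DF(u) maps the first to the second, and this is the
law ([connection_transition]).  The fields X and Y live on the domain of phi
only, and the formula applies to them once they are known to be smooth there.
Their principal parts are compositions of a derivative of a transition map with
another transition map, so this rests on the closure of the classes C^k under
bounded bilinear maps and composition ([Ck_bilinear], [Ck_comp]).

On the limit, a map of plim E that near u acts on the i-th component through a
differentiable map g_i has a directional derivative whose i-th component is the
differential of g_i ([fderiveE]): convergence in plim E is componentwise, and
the threads are preserved because the bonding maps are continuous.  The
transition map of two limit charts is of this kind on the overlap of their
domains, a neighbourhood of u because [lim_inv] is continuous at u, and so is
its first derivative along a fixed direction.  Reading the law on plim E in each
component gives the law on M_i. *)

(** * Bounded operators and differentials *)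

Section BoundedOperators.
Context {R : realType}.
Implicit Types V W : normedModType R.

Lemma Lop_le V W (L : Lop V W) x : `|L x| <= `|L| * `|x|.
Proof.
have [->|x0] := eqVneq x 0; first by rewrite Lop0 !normr0 mulr0.
have nx0 : 0 < `|x| by rewrite normr_gt0.
have : `|L (`|x|^-1 *: x)| <= `|L|.
  apply: le_supnorm; first exact: Lop_bounded.
  by rewrite /= normrZ normfV normr_id mulVf ?gt_eqF.
by rewrite LopZ normrZ normfV normr_id ler_pdivrMl // mulrC.
Qed.

Lemma Lop_norm_le V W (L : Lop V W) K : 0 <= K ->
  (forall x, `|L x| <= K * `|x|) -> `|L| <= K.
Proof.
move=> K0 LK; apply: supnorm_le; first by exists 0; rewrite /= normr0.
by move=> x /= x1; apply: (le_trans (LK x)); rewrite ler_piMr.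
Qed.

(** Totalised by the zero operator, so that operators may be built by functions
of their data without carrying proofs of linearity and boundedness. *)
Definition to_Lop V W (f : V -> W) : Lop V W := insubd 0 f.

Lemma continuous_linear_op V W (f : V -> W) K : linear f ->
  (forall x, `|f x| <= K * `|x|) -> continuous f.
Proof.
move=> lf fK; pose fM := GRing.isLinear.Build _ _ _ _ _ lf.
pose fL : {linear _ -> _} := HB.pack f fM.
apply: (@bounded_linear_continuous _ _ _ fL).
apply/linear_boundedP; exists `|K|; split; first exact: normr_real.
move=> C KC x; apply: (le_trans (fK x)); apply: ler_wpM2r => //.
by apply: (le_trans (ler_norm K)); exact: ltW.
Qed.

Lemma to_LopE V W (f : V -> W) K : linear f ->
  (forall x, `|f x| <= K * `|x|) -> to_Lop f =1 f.
Proof.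
move=> lf fK x; rewrite /to_Lop /Lop_fun val_insubd ifT //.
by apply/asboolP; split => //; exact: continuous_linear_op fK.
Qed.

Lemma Lop_ext V W (L L' : Lop V W) : L =1 L' -> L = L'.
Proof. by move=> LL'; apply/val_inj/funext. Qed.

(** The little-o expansion with its epsilon visible: in this form the condition
depends on the germ of [f] at [x] only. *)
Lemma is_diffP V W (f df : V -> W) (x : V) :
  is_diff x f df <->
  [/\ linear df, continuous df & forall eps, 0 < eps ->
    \forall h \near 0, `|f (h + x) - (f x + df h)| <= eps * `|h|].
Proof.
split=> [[dfx <-]|[ldf cdf dfP]].
  split; [exact: linearP|exact: diff_continuous|].
  by move: (diff_locally dfx) => /eqaddoP.
pose dfM := GRing.isLinear.Build _ _ _ _ _ ldf.
pose dfL : {linear _ -> _} := HB.pack df dfM.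
have expf : f \o shift x = cst (f x) + dfL +o_ 0 id by apply/eqaddoP.
have dE : 'd f x = dfL :> (V -> W) by exact: diff_unique.
by split=> //; apply/diff_locallyP; rewrite dE.
Qed.

Lemma near_is_diff V W (f g df : V -> W) (x : V) :
  (\forall y \near x, f y = g y) -> is_diff x f df -> is_diff x g df.
Proof.
move=> fg /is_diffP[ldf cdf dfP]; apply/is_diffP; split=> // eps eps0.
have fgx := nbhs_singleton fg.
move: fg; rewrite (near_shift 0 x) /= => fg.
near=> h; rewrite -fgx.
have <- : f (h + x) = g (h + x).
  by near: h; apply: filterS fg => h /=; rewrite subr0.
by near: h; exact: dfP.
Unshelve. all: by end_near. Qed.

Lemma near_diff V W (f g : V -> W) (x : V) :
  (\forall y \near x, f y = g y) -> differentiable f x ->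
  'd g x = 'd f x :> (V -> W).
Proof. by move=> fg /differentiableP/(near_is_diff fg)[]. Qed.

End BoundedOperators.

(** * Bounded bilinear maps *)

Section BoundedBilinear.
Context {R : realType}.
Implicit Types A B C V W : normedModType R.

Definition bounded_bilinear A B C (b : A -> B -> C) :=
  [/\ forall x, linear (b x), forall y, linear (b^~ y) &
    exists2 K, 0 <= K & forall x y, `|b x y| <= K * `|x| * `|y|].

(** Near (x, y), b(x', y') - b(x, y) is the sum of b(x' - x, y' - y),
b(x, y' - y) and b(x' - x, y), each of which the bound makes small. *)
Lemma bilinear_continuous A B C (b : A -> B -> C) :
  bounded_bilinear b -> continuous (fun p => b p.1 p.2).
Proof.
move=> [rb lb [K K0 bK]] [x y].
have bD x1 x2 z : b (x1 + x2) z = b x1 z + b x2 z.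
  by have := lb z 1 x1 x2; rewrite /= !scale1r.
have bDr z y1 y2 : b z (y1 + y2) = b z y1 + b z y2.
  by have := rb z 1 y1 y2; rewrite !scale1r.
apply/subr_cvg0/norm_cvg0P => /=.
pose h (p : A * B) : R := K * `|p.1 - x| * `|p.2 - y|
  + (K * `|x| * `|p.2 - y| + K * `|p.1 - x| * `|y|).
have h0 : h p @[p --> (x, y)] --> (0 : R).
  have n1 : `|p.1 - x| @[p --> (x, y)] --> (0 : R).
    by apply/norm_cvg0P/subr_cvg0; exact: cvg_fst.
  have n2 : `|p.2 - y| @[p --> (x, y)] --> (0 : R).
    by apply/norm_cvg0P/subr_cvg0; exact: cvg_snd.
  have -> : (0 : R) = K * 0 * 0 + (K * `|x| * 0 + K * 0 * `|y|).
    by rewrite !(mulr0, mul0r, addr0).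
  apply: cvgD; first by apply: cvgM => //; apply: cvgM => //; exact: cvg_cst.
  apply: cvgD; first by apply: cvgM => //; exact: cvg_cst.
  by apply: cvgM; [apply: cvgM => //|]; exact: cvg_cst.
apply: (squeeze_cvgr _ (cvg_cst _) h0); near=> p.
rewrite normr_ge0 /=.
have key u v : b (u + x) (v + y) - b x y = b u v + (b x v + b u y).
  by rewrite bD !bDr -!addrA; congr (_ + _); rewrite subrr addr0 addrC.
have := key (p.1 - x) (p.2 - y); rewrite !subrK => ->.
apply: (le_trans (ler_normD _ _)); apply: lerD => //.
by apply: (le_trans (ler_normD _ _)); exact: lerD.
Unshelve. all: by end_near. Qed.

Lemma is_diff_bilinear V A B C (b : A -> B -> C) (f df : V -> A)
    (g dg : V -> B) x : bounded_bilinear b ->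
  is_diff x f df -> is_diff x g dg ->
  is_diff x (fun y => b (f y) (g y))
    (fun h => b (df h) (g x) + b (f x) (dg h)).
Proof.
move=> bb dfx dgx; have [rb lb _] := bb.
have cb := bilinear_continuous bb.
have bbl : bilinear_for (GRing.Scale.Law.clone _ _ *:%R _)
    (GRing.Scale.Law.clone _ _ *:%R _) b.
  by split => ? ? ? ?; [exact: lb|exact: rb].
pose bM := bilinear_isBilinear.Build R A B C _ _ b bbl.
pose bL : {bilinear _ -> _ -> _} := HB.pack b bM.
have dp := is_diff_pair dfx dgx.
have db : is_diff (f x, g x) (fun q => bL q.1 q.2)
    (fun q => bL (f x) q.2 + bL q.1 (g x)).
  split; first exact: differentiable_bilin.
  by rewrite diff_bilin.
refine (@is_diff_eq _ _ _ _ _ _ _ (is_diff_comp dp db) _).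
by apply/funext => h /=; rewrite addrC.
Qed.

(** The Leibniz rule for b(f, g) reads D(b(f, g)) = bil_op b (Df) g +
bil_op (bil_flip b) (Dg) f.  It expresses the derivative through bounded
bilinear maps again, which is what makes induction on the order of
differentiability possible. *)
Definition bil_op A B C V (b : A -> B -> C) (L : Lop V A) (y : B) : Lop V C :=
  to_Lop (fun h => b (L h) y).

Definition bil_flip A B C (b : A -> B -> C) y x := b x y.

Lemma bil_flip_bilinear A B C (b : A -> B -> C) :
  bounded_bilinear b -> bounded_bilinear (bil_flip b).
Proof.
move=> [rb lb [K K0 bK]]; split=> //; exists K => // x y.
by rewrite mulrAC; exact: bK.
Qed.

Lemma bil_opE A B C V (b : A -> B -> C) (L : Lop V A) y h :
  bounded_bilinear b -> bil_op b L y h = b (L h) y.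
Proof.
move=> [rb lb [K K0 bK]].
rewrite (to_LopE (f := fun h => b (L h) y) (K := K * `|L| * `|y|)) //.
  by move=> a u v; rewrite Lop_linear lb.
move=> x; apply: (le_trans (bK _ _)).
by rewrite [leRHS]mulrAC ler_wpM2r // -mulrA ler_wpM2l // Lop_le.
Qed.

Lemma bil_op_bilinear A B C V (b : A -> B -> C) :
  bounded_bilinear b -> bounded_bilinear (@bil_op A B C V b).
Proof.
move=> bb; have [rb lb [K K0 bK]] := bb.
have LopD W (L L' : Lop V W) a h :
  Lop_fun (a *: L + L') h = a *: L h + L' h by [].
split.
- by move=> L a x y; apply: Lop_ext => h; rewrite LopD !bil_opE // rb.
- by move=> y a L L'; apply: Lop_ext => h; rewrite LopD !bil_opE // LopD lb.
exists K => // L y; apply: Lop_norm_le; first by rewrite !mulr_ge0.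
move=> h; rewrite bil_opE //; apply: (le_trans (bK _ _)).
by rewrite [leRHS]mulrAC ler_wpM2r // -mulrA ler_wpM2l // Lop_le.
Qed.

Definition Lop_app V W (L : Lop V W) (x : V) : W := L x.

Lemma Lop_app_bilinear V W : bounded_bilinear (@Lop_app V W).
Proof.
split.
- exact: Lop_linear.
- by move=> y a L L'.
by exists 1 => // L x; rewrite mul1r; exact: Lop_le.
Qed.

End BoundedBilinear.

(** * The classes C^k *)

Section SmoothCalculus.
Context {R : realType}.
Implicit Types A B C V W : normedModType R.

Lemma Ck_pred k V W (U : set V) (f : V -> W) : Ck k.+1 U f -> Ck k U f.
Proof.
elim: k V W U f => [|k IH] V W U f.
  move=> [f' df _] x Ux; apply: differentiable_continuous.
  by have [] := df x Ux.
by move=> [f' df cf]; exists f' => //; exact: IH.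
Qed.

Lemma Ck_cst k V W (U : set V) (a : W) : Ck k U (fun=> a).
Proof.
elim: k V W U a => [|k IH] V W U a /=.
  by move=> x _; exact: cvg_cst.
by exists (fun=> 0) => [x _|]; [exact: is_diff_cst|exact: IH].
Qed.

Lemma CkD k V W (U : set V) (f g : V -> W) :
  Ck k U f -> Ck k U g -> Ck k U (fun x => f x + g x).
Proof.
elim: k V W U f g => [|k IH] V W U f g /=.
  by move=> cf cg x Ux; apply: cvgD; [exact: cf|exact: cg].
move=> [f' df cf] [g' dg cg]; exists (fun x => f' x + g' x); last exact: IH.
by move=> x Ux; exact: is_diffD (df x Ux) (dg x Ux).
Qed.

(** By induction on k for all bounded bilinear maps at once: the derivative is a
sum of two terms of the same form, with [bil_op b] and
[bil_op (bil_flip b)] in the place of [b]. *)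
Lemma Ck_bilinear k V A B C (U : set V) (b : A -> B -> C)
    (f : V -> A) (g : V -> B) : bounded_bilinear b ->
  Ck k U f -> Ck k U g -> Ck k U (fun x => b (f x) (g x)).
Proof.
elim: k V A B C U b f g => [|k IH] V A B C U b f g bb.
  move=> cf cg x Ux.
  apply: (continuous_comp (f := fun y => (f y, g y))
    (g := fun p => b p.1 p.2)); last exact: bilinear_continuous.
  by apply: cvg_pair; [exact: cf|exact: cg].
move=> Cf Cg; have [f' df cf] := Cf; have [g' dg cg] := Cg.
exists (fun x => bil_op b (f' x) (g x) + bil_op (bil_flip b) (g' x) (f x)).
  move=> x Ux; apply: is_diff_eq (is_diff_bilinear bb (df x Ux) (dg x Ux)) _.
  apply/funext => h.
  rewrite -[RHS]/(bil_op b (f' x) (g x) h + bil_op (bil_flip b) (g' x) (f x) h).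
  by rewrite !bil_opE //; exact: bil_flip_bilinear.
apply: CkD; apply: IH => //.
- exact: bil_op_bilinear.
- exact: Ck_pred.
- by apply: bil_op_bilinear; exact: bil_flip_bilinear.
- exact: Ck_pred.
Qed.

Lemma eq_Ck k V W (U : set V) (f g : V -> W) : open U ->
  (forall x, U x -> f x = g x) -> Ck k U f -> Ck k U g.
Proof.
move=> oU fg; have fgx x : U x -> \forall y \near x, f y = g y.
  by move=> Ux; apply: filterS (open_nbhs_nbhs (conj oU Ux)) => y /fg.
case: k => [|k] /=.
  move=> cf x Ux; suff : g y @[y --> x] --> f x by rewrite fg.
  by apply: cvg_trans (cf x Ux); apply: near_eq_cvg; exact: fgx.
move=> [f' df cf]; exists f' => // x Ux.
exact: near_is_diff (fgx x Ux) (df x Ux).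
Qed.

(** Composition as an instance of [bil_op], whose bilinearity is thus
inherited. *)
Definition Lop_comp A B C (L : Lop B C) (L' : Lop A B) : Lop A C :=
  bil_op (bil_flip (@Lop_app R B C)) L' L.

Lemma Lop_compE A B C (L : Lop B C) (L' : Lop A B) x :
  Lop_comp L L' x = L (L' x).
Proof.
rewrite /Lop_comp bil_opE //.
by apply: bil_flip_bilinear; exact: Lop_app_bilinear.
Qed.

(** The chain rule gives D(g o f) = (Dg o f) o Df, a bounded bilinear expression
in Dg o f, which is C^k by induction, and Df. *)
Lemma Ck_comp k V A B (U : set V) (T : set A) (f : V -> A) (g : A -> B) :
  (forall x, U x -> T (f x)) -> Ck k U f -> Ck k T g -> Ck k U (g \o f).
Proof.
elim: k V A B U T f g => [|k IH] V A B U T f g UT.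
  move=> cf cg x Ux; apply: continuous_comp; first exact: cf.
  by apply: cg; exact: UT.
move=> Cf [g' dg cg]; have [f' df cf] := Cf.
exists (fun x => Lop_comp (g' (f x)) (f' x)).
  move=> x Ux.
  apply: is_diff_eq (is_diff_comp (df x Ux) (dg _ (UT x Ux))) _.
  by apply/funext => h; rewrite Lop_compE.
rewrite /Lop_comp; apply: Ck_bilinear => //.
- by apply: bil_op_bilinear; apply: bil_flip_bilinear; exact: Lop_app_bilinear.
- by apply: IH cg => //; exact: Ck_pred.
Qed.

Lemma smooth_is_diff V W (U : set V) (f : V -> W) x :
  smooth_on U f -> U x -> differentiable f x.
Proof. by move=> /(_ 1%N)[f' df _] Ux; have [] := df x Ux. Qed.

(** On [U], ['d f] agrees with the operator-valued derivative that [Ck] provides,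
and evaluation at [e] is bilinear. *)
Lemma smooth_diff V W (U : set V) (f : V -> W) e : open U ->
  smooth_on U f -> smooth_on U (fun x => 'd f x e).
Proof.
move=> oU sf k; have [f' df cf] := sf k.+1.
apply: (@eq_Ck _ _ _ _ (fun x => f' x e)) => //.
  by move=> x Ux; have [_ ->] := df x Ux.
by apply: (Ck_bilinear (b := @Lop_app R V W)) cf _;
  [exact: Lop_app_bilinear|exact: Ck_cst].
Qed.

End SmoothCalculus.

(** * Christoffel symbols of a Banach manifold under a change of charts *)

Section Charts.
Context {N : topologicalType} {R : realType} {E : normedModType R}.
Implicit Types phi : chart N E.

Lemma chartK phi m : cdom phi m -> cinv phi (phi m) = m.
Proof. by move=> dm; apply: (cmapK (c := phi)); rewrite inE. Qed.

Lemma near_chart_img phi (W : set N) m : open W -> cdom phi m -> W m ->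
  \forall u \near phi m, (phi @` (cdom phi `&` W)) u.
Proof.
move=> oW dm Wm; have im : (phi @` cdom phi) (phi m) by exists m.
have imU : \forall u \near phi m, (phi @` cdom phi) u.
  by apply: open_nbhs_nbhs; split => //; exact: cmap_open.
have invW : \forall u \near phi m, W (cinv phi u).
  apply: (cinv_cont im); rewrite chartK //.
  by apply: open_nbhs_nbhs.
near=> u; have [m' dm' um'] : (phi @` cdom phi) u by near: u.
exists m' => //; split=> //; rewrite -(chartK dm') um'.
by near: u.
Unshelve. all: by end_near. Qed.

Lemma open_chart_img phi (W : set N) : open W ->
  open (phi @` (cdom phi `&` W)).
Proof.
move=> oW; rewrite openE => _ [m [dm Wm] <-].
exact: near_chart_img.
Qed.

End Charts.

Section LocalConnection.
Context {R : realType} {E : completeNormedModType R} {N : bmanifold E}.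
Implicit Types (phi psi chi : chart N E) (m : N).

Lemma differentiable_transition phi psi m : chart_at m phi -> chart_at m psi ->
  differentiable (psi \o cinv phi) (phi m).
Proof.
move=> [aphi dphi] [apsi dpsi].
by apply: (smooth_is_diff (atlas_smooth aphi apsi)); exists m.
Qed.

Lemma diff_transition_id phi m e : chart_at m phi ->
  'd (phi \o cinv phi) (phi m) e = e.
Proof.
move=> [aphi dphi]; have di := is_diff_id (phi m).
rewrite (near_diff (f := id)) //; first by rewrite (@diff_val _ _ _ _ _ _ _ di).
near=> u; have [m' [dm' _] <-] : (phi @` (cdom phi `&` [set: N])) u.
  by near: u; apply: near_chart_img => //; exact: openT.
by rewrite /= chartK.
Unshelve. all: by end_near. Qed.

Lemma diff_transition_comp phi psi chi m e :
  chart_at m phi -> chart_at m psi -> chart_at m chi ->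
  'd (chi \o cinv phi) (phi m) e =
  'd (chi \o cinv psi) (psi m) ('d (psi \o cinv phi) (phi m) e).
Proof.
move=> cphi cpsi cchi.
have psiE : psi m = (psi \o cinv phi) (phi m).
  by rewrite /= chartK //; case: cphi.
have d1 := differentiable_transition cphi cpsi.
have d2 := differentiable_transition cpsi cchi.
rewrite psiE in d2 *.
rewrite (near_diff (f := (chi \o cinv psi) \o (psi \o cinv phi))).
- by rewrite diff_comp.
- near=> u.
  have [m' [dm' dm''] <-] : (phi @` (cdom phi `&` cdom psi)) u.
    near: u; case: cphi cpsi => _ ? [_ ?].
    by apply: near_chart_img => //; exact: cdom_open.
  by rewrite /= (chartK dm') (chartK dm'').
- exact: differentiable_comp.
Unshelve. all: by end_near. Qed.

(** Principal part at [m], in the chart [chi], of the vector field that is constant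
in [phi]; zero outside the domain of [phi], as a section is defined on all of
[N]. *)
Definition const_ppart phi (e : E) m chi : E :=
  if `[< chart_at m phi /\ chart_at m chi >]
  then 'd (chi \o cinv phi) (phi m) e else 0.

Lemma const_ppart_compat phi e m chi psi :
  chart_at m chi -> chart_at m psi ->
  const_ppart phi e m psi =
    'd (psi \o cinv chi) (chi m) (const_ppart phi e m chi).
Proof.
move=> cchi cpsi; rewrite /const_ppart.
have [cphi|ncphi] := pselect (chart_at m phi).
  by rewrite !asboolT //; exact: diff_transition_comp.
by rewrite !asboolF ?linear0 // => -[].
Qed.

Lemma const_ppart_junk phi e m chi :
  ~ chart_at m chi -> const_ppart phi e m chi = 0.
Proof. by move=> nc; rewrite /const_ppart asboolF // => -[]. Qed.

Definition const_vf phi e : section N := fun m =>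
  Tangent (@const_ppart_compat phi e m) (@const_ppart_junk phi e m).

Lemma const_vf_ppart phi chi e m : chart_at m phi -> chart_at m chi ->
  vf_ppart (const_vf phi e) chi (chi m) = 'd (chi \o cinv phi) (phi m) e.
Proof.
move=> cphi cchi; rewrite /vf_ppart /= chartK; last by case: cchi.
by rewrite /const_ppart asboolT.
Qed.

(** In a chart [chi] the principal part is D o (phi o chi^-1), with D the
derivative of the transition map from [phi] to [chi] along [e]. *)
Lemma smooth_const_vf phi e : atlas phi ->
  smooth_vf (cdom phi) (const_vf phi e).
Proof.
move=> aphi chi achi k.
pose D u := 'd (chi \o cinv phi) u e.
have oU : open (chi @` (cdom chi `&` cdom phi)).
  by apply: open_chart_img; exact: cdom_open.
apply: (@eq_Ck _ _ _ _ _ (D \o (phi \o cinv chi))) => //.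
  move=> _ [m [dchi dphi] <-].
  by rewrite const_vf_ppart // /D /= chartK.
apply: (Ck_comp (T := phi @` (cdom phi `&` cdom chi))).
- by move=> _ [m [dchi dphi] <-] /=; rewrite chartK //; exists m.
- exact: atlas_smooth.
- apply: smooth_diff; last exact: atlas_smooth.
  by apply: open_chart_img; exact: cdom_open.
Qed.

(** The covariant derivative of one field constant in [phi] along another has
principal parts in [phi] and in [psi] that [Gamma] computes; the law says that
they represent the same tangent vector. *)
Lemma connection_transition nabla Gamma phi psi m e1 e2 :
  @is_connection R E N nabla Gamma -> chart_at m phi -> chart_at m psi ->
  let F := psi \o cinv phi in let u := phi m in
  Gamma psi (psi m) ('d F u e1) ('d F u e2) =
    'd F u (Gamma phi u e1 e2) + 'd (fun u' => 'd F u' e2) u e1.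
Proof.
move=> [_ nablaP] cphi cpsi F u.
have [aphi dphi] := cphi; have [apsi dpsi] := cpsi.
pose W := cdom phi; have oW : open W by exact: cdom_open.
pose X := const_vf phi e1; pose Y := const_vf phi e2.
have sX : smooth_vf W X by exact: smooth_const_vf.
have sY : smooth_vf W Y by exact: smooth_const_vf.
pose Z := nabla W X Y.
have Zphi : vf_ppart Z phi u = - Gamma phi u e1 e2.
  have [_ /(_ W X Y oW sX sY u)->] := nablaP phi aphi; last by exists m.
  rewrite !const_vf_ppart // !diff_transition_id //.
  rewrite (near_diff (f := cst e2)); first by rewrite diff_cst sub0r.
    near=> u'; have [m' [dm' _] <-] : (phi @` (cdom phi `&` W)) u'.
      by near: u'; exact: near_chart_img.
    by rewrite const_vf_ppart // diff_transition_id.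
  exact: differentiable_cst.
have Zpsi : vf_ppart Z psi (psi m) =
    'd (vf_ppart Y psi) (psi m) ('d F u e1)
    - Gamma psi (psi m) ('d F u e1) ('d F u e2).
  have [_ /(_ W X Y oW sX sY (psi m))->] := nablaP psi apsi; last by exists m.
  by rewrite !const_vf_ppart.
have ZZ : vf_ppart Z psi (psi m) = 'd F u (vf_ppart Z phi u).
  by rewrite /vf_ppart !chartK //; exact: ppart_compat.
pose D u' := 'd F u' e2.
have dD : differentiable D u.
  apply: (@smooth_is_diff _ _ _ (phi @` (cdom phi `&` cdom psi))).
    apply: smooth_diff; last exact: atlas_smooth.
    by apply: open_chart_img; exact: cdom_open.
  by exists m.
(* Y_psi = D o (phi o psi^-1) near psi m, and the differential of phi o psi^-1
   takes DF(u) e1 back to e1. *)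
have dG := differentiable_transition cpsi cphi.
have uE : u = (phi \o cinv psi) (psi m) by rewrite /= chartK.
have dY : 'd (vf_ppart Y psi) (psi m) ('d F u e1) = 'd D u e1.
  rewrite (near_diff (f := D \o (phi \o cinv psi))).
  - rewrite diff_comp //; last by rewrite -uE.
    by rewrite /= -diff_transition_comp // diff_transition_id // chartK.
  - near=> v; have [m' [dm' dm''] <-] : (psi @` (cdom psi `&` cdom phi)) v.
      by near: v; apply: near_chart_img => //; exact: cdom_open.
    by rewrite const_vf_ppart // /D /= chartK.
  - by apply: differentiable_comp => //; rewrite -uE.
move: Zpsi; rewrite ZZ Zphi dY linearN => /eqP.
rewrite eq_sym subr_eq addrC => /eqP ->.
by rewrite subrKC.
Unshelve. all: by end_near. Qed.

End LocalConnection.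

(** * Projective limits of Banach spaces *)

(** Threads of spaces and threads of points of manifolds both carry the topology
induced by the product, so this covers [plim] and [mlim] alike. *)
Lemma cvg_initial_prod (I : eqType) (T : I -> topologicalType) (S : choiceType)
    (f : S -> prod_topology T) (F : set_system S) (s : S) : Filter F ->
  F --> (s : initial_topology f) <->
  forall i, (fun y => f y i) @ F --> f s i.
Proof.
move=> FF; split=> [Fs i|Fs].
  have cf : (f : initial_topology f -> _) y @[y --> F] --> f s.
    by apply: cvg_trans (@initial_continuous _ _ f s); exact: cvg_app.
  apply: cvg_trans (@proj_continuous _ _ i (f s)).
  exact: (cvg_app (@proj I T i) cf).
have cf : f @ F --> f s.
  apply/cvg_sup => i A; rewrite nbhsE => -[B [[V oV <-] Vfs] sBA].
  have FV : F (fun y => V (f y i)) by apply: (Fs i); exact: open_nbhs_nbhs.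
  change (F (f @^-1` A)); apply: filterS FV => y Vy; exact: sBA.
move=> A; rewrite nbhsE => -[B [[V oV <-] Vs] sBA].
have FV : F (f @^-1` V) by apply: cf; exact: open_nbhs_nbhs.
exact: filterS sBA FV.
Qed.

Section Threads.
Context {R : realType} {E : banach_system R}.
Implicit Types x y u e : plim E.

Lemma plim_thread x i j (ij : (i <= j)%N) : rho E ij (x j) = x i.
Proof. by have /asboolP := valP x; exact. Qed.

Lemma plim_ext x y : (forall i, x i = y i) -> x = y.
Proof. by move=> xy; apply/val_inj/functional_extensionality_dep. Qed.

Lemma mk_plimE (x : forall i, E i) :
  (forall i j (ij : (i <= j)%N), rho E ij (x j) = x i) ->
  forall i, mk_plim x i = x i.
Proof.
move=> tx i; rewrite /mk_plim /plim_at val_insubd ifT //.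
by apply/asboolP.
Qed.

Lemma mk_H2E (B : forall i, Bop (E i) (E i)) :
  (forall i j (ij : (i <= j)%N) (a b : E j),
     B i (rho E ij a) (rho E ij b) = rho E ij (B j a b)) ->
  forall i, mk_H2 B i = B i.
Proof.
move=> tB i; rewrite /mk_H2 /H2_at val_insubd ifT //.
by apply/asboolP.
Qed.

Lemma H2_appE (B : H2 E) x y i : H2_app B x y i = B i (x i) (y i).
Proof.
rewrite /H2_app mk_plimE // => {}i j ij.
by have /asboolP/(_ i j ij) := valP B; rewrite -!(plim_thread _ ij) => <-.
Qed.

Lemma cvg_plim {X : Type} (F : set_system X) (g : X -> plim E) x : Filter F ->
  g @ F --> x <-> forall i, (fun z => g z i) @ F --> x i.
Proof. by move=> FF; exact: cvg_initial_prod. Qed.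

Lemma lim_plim {X : Type} (F : set_system X) (g : X -> plim E) x :
  ProperFilter F -> g @ F --> x -> lim (g @ F) = x.
Proof.
move=> FF gx; apply: plim_ext => i.
have /cvg_plim/(_ i) gi := gx.
have /cvg_plim/(_ i) li := cvgP _ gx.
exact: (cvg_unique (@norm_hausdorff _ _) li gi).
Qed.

(** The limit of the difference quotients is taken componentwise, where it is a
directional derivative in a Banach space. *)
Lemma fderiveE (f : plim E -> plim E) (g : forall i, E i -> E i) u e :
  (forall i, \forall u' \near u, f u' i = g i (u' i)) ->
  (forall i, differentiable (g i) (u i)) ->
  forall i, fderive f u e i = 'd (g i) (u i) (e i).
Proof.
move=> fg dg.
have line : u + t *: e @[t --> (0 : R)^'] --> u.
  apply/cvg_plim => i; rewrite -[X in _ --> X](addr0 (u i)).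
  apply: (cvgD (f := fun=> u i) (g := fun t => t *: e i)); first exact: cvg_cst.
  rewrite -[X in _ --> X](scale0r (e i)); apply: cvgZr_tmp.
  by apply: cvg_within_filter; exact: cvg_id.
have linefg i : \forall t \near (0 : R)^',
    f (u + t *: e) i = g i (plim_at (u + t *: e) i) by exact: line _ (fg i).
have dq i : plim_at (diff_quot f u e t) i @[t --> (0 : R)^'] -->
    'd (g i) (u i) (e i).
  have := @diff_derivable _ _ _ (g i) (u i) (e i) (dg i).
  rewrite -(deriveE _ (dg i)); apply: cvg_trans; apply: near_eq_cvg.
  apply: filterS (linefg i) => t ft /=.
  rewrite -[RHS]/(t^-1 *: (plim_at (f (u + t *: e)) i - f u i)).
  rewrite ft (nbhs_singleton (fg i)).
  by rewrite [t *: _ + _]addrC.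
(* Each bonding map sends the j-th difference quotient to the i-th one, hence
   also their limits. *)
have thr i j (ij : (i <= j)%N) :
    rho E ij ('d (g j) (u j) (e j)) = 'd (g i) (u i) (e i).
  apply: (cvg_unique (@norm_hausdorff _ _)) (dq i).
  have := cvg_comp _ _ (dq j) (@Lop_continuous _ _ _ (rho E ij) _).
  rewrite (_ : _ \o _ = fun t => plim_at (diff_quot f u e t) i) //.
  by apply/funext => t; exact: plim_thread.
move=> i; rewrite /fderive.
have -> : lim (diff_quot f u e t @[t --> 0^']) =
    mk_plim (fun i => 'd (g i) (u i) (e i)).
  by apply: lim_plim; apply/cvg_plim => k; rewrite mk_plimE.
by rewrite mk_plimE.
Qed.

End Threads.

(** * Transition maps between limit charts *)

Section LimitCharts.
Context {R : realType} {E : banach_system R} {M : manifold_system E}.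
Implicit Types (phi psi : pchart M) (m : mlim M) (u e : plim E).

Lemma mlim_thread m i j (ij : (i <= j)%N) : mmap M ij (m j) = m i.
Proof. by have /asboolP := valP m; exact. Qed.

Lemma lim_mapE phi m i : lim_dom phi m -> lim_map phi m i = phi i (m i).
Proof.
move=> dm; rewrite /lim_map mk_plimE // => {}i j ij.
by rewrite -(pc_commute ij (dm j)) mlim_thread.
Qed.

Lemma cvg_mlim {X : Type} (F : set_system X) (g : X -> mlim M) m : Filter F ->
  g @ F --> m <-> forall i, (fun z => g z i) @ F --> m i.
Proof. by move=> FF; exact: cvg_initial_prod. Qed.

(** Continuity of [lim_inv] at the points of the image comes from the charts of
the M_i: on the image, its i-th component is the inverse of [phi i] applied to
the i-th component. *)
Lemma lim_inv_cvg phi m : lim_dom phi m ->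
  lim_inv phi u @[u --> lim_map phi m] --> m.
Proof.
move=> dm; apply: (iffRL (cvg_mlim _ _ (nbhs_filter (lim_map phi m)))) => i.
have img : \forall u \near lim_map phi m, pc_img phi u.
  by apply: open_nbhs_nbhs; split; [exact: pc_img_open|exists m].
have proj_i : u i @[u --> lim_map phi m] --> phi i (m i).
  rewrite -lim_mapE //.
  have := iffLR (cvg_plim (fun u => u) (lim_map phi m)
    (nbhs_filter (lim_map phi m))) cvg_id; exact.
have cinv_i : cinv (phi i) v @[v --> phi i (m i)] --> m i.
  rewrite -[X in _ --> X](chartK (dm i)).
  by apply: cinv_cont; exists (m i).
apply: cvg_trans (cvg_comp _ _ proj_i cinv_i); apply: near_eq_cvg.
apply: filterS img => _ [m' dm' <-] /=.
by rewrite lim_mapE // lim_mapK // chartK.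
Qed.

(** Openness of [lim_dom psi] transports to [plim E] by continuity of
[lim_inv phi]. *)
Lemma near_lim_overlap phi psi m : lim_dom phi m -> lim_dom psi m ->
  \forall u \near lim_map phi m,
    exists m', [/\ lim_dom phi m', lim_dom psi m' & lim_map phi m' = u].
Proof.
move=> dphi dpsi.
have img : \forall u \near lim_map phi m, pc_img phi u.
  by apply: open_nbhs_nbhs; split; [exact: pc_img_open|exists m].
have inv : \forall u \near lim_map phi m, lim_dom psi (lim_inv phi u).
  apply: (lim_inv_cvg dphi); apply: open_nbhs_nbhs.
  by split => //; exact: pc_dom_open.
near=> u; have [m' dm' um'] : pc_img phi u by near: u.
exists m'; split => //; rewrite -(lim_mapK dm') um'.
by near: u.
Unshelve. all: by end_near. Qed.

Lemma chart_at_lim phi m i : lim_dom phi m -> chart_at (m i) (phi i).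
Proof. by move=> dm; split; [exact: pc_atlas|exact: dm]. Qed.

Lemma fderive_ptransition phi psi m e i : lim_dom phi m -> lim_dom psi m ->
  fderive (ptransition phi psi) (lim_map phi m) e i =
  'd (psi i \o cinv (phi i)) (phi i (m i)) (e i).
Proof.
move=> dphi dpsi.
rewrite (fderiveE (g := fun i => psi i \o cinv (phi i))) ?lim_mapE //.
  move=> k; near=> u; have [m' [dphi' dpsi' <-]] : exists m',
      [/\ lim_dom phi m', lim_dom psi m' & lim_map phi m' = u].
    by near: u; exact: near_lim_overlap.
  by rewrite /ptransition /= lim_mapK // !lim_mapE // chartK.
by move=> k; rewrite lim_mapE //; apply: differentiable_transition;
  exact: chart_at_lim.
Unshelve. all: by end_near. Qed.

Lemma fderive2_ptransition phi psi m e1 e2 i :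
  lim_dom phi m -> lim_dom psi m ->
  fderive2 (ptransition phi psi) (lim_map phi m) e1 e2 i =
  'd (fun a : E i => 'd (psi i \o cinv (phi i)) a (e2 i)) (phi i (m i)) (e1 i).
Proof.
move=> dphi dpsi.
rewrite /fderive2 (fderiveE
  (g := fun i (a : E i) => 'd (psi i \o cinv (phi i)) a (e2 i))) ?lim_mapE //.
  move=> k; near=> u; have [m' [dphi' dpsi' <-]] : exists m',
      [/\ lim_dom phi m', lim_dom psi m' & lim_map phi m' = u].
    by near: u; exact: near_lim_overlap.
  by rewrite fderive_ptransition // lim_mapE.
move=> k; rewrite lim_mapE //.
apply: (@smooth_is_diff _ _ _ (phi k @` (cdom (phi k) `&` cdom (psi k)))).
  apply: smooth_diff; first by apply: open_chart_img; exact: cdom_open.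
  by apply: atlas_smooth; exact: pc_atlas.
by exists (m k).
Unshelve. all: by end_near. Qed.

Lemma lim_componentsE
    (Gamma : forall i, chart (M i) (E i) -> E i -> Bop (E i) (E i)) phi m i :
  projective_components Gamma -> lim_dom phi m ->
  lim_components Gamma phi (lim_map phi m) i =
  Gamma i (phi i) (phi i (m i)).
Proof.
move=> pGamma dm; rewrite /lim_components mk_H2E ?lim_mapE // => {}i j ij a b.
rewrite -(plim_thread (lim_map phi m) ij) -pGamma //.
by rewrite lim_mapE //; exists (m j).
Qed.

End LimitCharts.

Theorem theorem3p2 (R : realType) (E : banach_system R)
    (M : manifold_system E)
    (nablas : forall i, set (M i) -> section (M i) -> section (M i) ->
       section (M i))
    (Gamma : forall i, chart (M i) (E i) -> E i -> Bop (E i) (E i))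
    (nabla : psection M -> psection M -> psection M) :
  has_pcharts M ->
  (forall i, is_connection (nablas i) (Gamma i)) ->
  projective_components Gamma ->
  is_lim_connection nablas nabla ->
  is_pconnection nabla (lim_components Gamma) ->
  christoffel_structure (lim_components Gamma).
Proof.
move=> _ nablasP pGamma _ [_ nablaP]; split=> [phi|phi psi m dphi dpsi].
  by have [] := nablaP phi.
move=> u v F e1 e2; apply: plim_ext => i.
rewrite -[RHS]/(
  plim_at (fderive F u (H2_app (lim_components Gamma phi u) e1 e2)) i +
  plim_at (fderive2 F u e1 e2) i).
rewrite H2_appE !fderive_ptransition // fderive2_ptransition // H2_appE.
rewrite !lim_componentsE //.
by apply: connection_transition (nablasP i) _ _; exact: chart_at_lim.
Qed.
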